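(* Assume the closure operator $\mathrm{cl}$ is finitary. For $F\subseteq\mathcal Q(\mathcal T)$ write $\uparrow F:=\{S\subseteq\mathcal T:\exists A\in F,\ A\subseteq S\}$, and for $K\subseteq\mathcal P(\mathcal T)$ write $K_{\mathrm f}:=K\cap\mathcal Q(\mathcal T)$. Then: (i) if $F$ is a finitely coherent SDFS, then $\uparrow F$ is a finitely coherent SDS; (ii) if $K$ is a coherent or finitely coherent SDS, then $K_{\mathrm f}$ is a finitely coherent SDFS; (iii) for every finitary finitely coherent SDS $K$, $\uparrow(K_{\mathrm f})=K$; (iv) for every finitely coherent SDFS $F$, $(\uparrow F)_{\mathrm f}=F$.
   Context: Let $\mathcal T$ be a non-empty set (of ''things''). Let $\mathrm{cl}:\mathcal P(\mathcal T)\to\mathcal P(\mathcal T)$ be a closure operator (extensive, monotone, idempotent); it is finitary if $\mathrm{cl}(A)=\bigcup\{\mathrm{cl}(G):G\subseteq A,\ G\text{ finite}\}$ for all $A\subseteq\mathcal T$. Let $\mathcal T_-\subseteq\mathcal T$ be a set of forbidden things and $\mathcal T_+:=\mathrm{cl}(\emptyset)$, with standing assumption $\mathcal T_+\cap\mathcal T_-=\emptyset$. $\mathcal Q(\mathcal T)$ is the set of finite subsets of $\mathcal T$ (including $\emptyset$). For $\mathcal W\subseteq\mathcal P(\mathcal T)$, $\Sigma_{\mathcal W}$ is the set of maps $\sigma:\mathcal W\to\mathcal T$ with $\sigma(S)\in S$ for all $S\in\mathcal W$, and $\sigma(\mathcal W):=\{\sigma(S):S\in\mathcal W\}$. An SDS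 is any $K\subseteq\mathcal P(\mathcal T)$. It is coherent if (K1) $\emptyset\notin K$; (K2) if $S_1\in K$ and $S_1\subseteq S_2\subseteq\mathcal T$ then $S_2\in K$; (K3) if $S\in K$ then $S\setminus\mathcal T_-\in K$; (K4) $\{t\}\in K$ for all $t\in\mathcal T_+$; (K5) for every non-empty $\mathcal W\subseteq K$ and every family $(t_\sigma)_{\sigma\in\Sigma_{\mathcal W}}$ with $t_\sigma\in\mathrm{cl}(\sigma(\mathcal W))$, $\{t_\sigma:\sigma\in\Sigma_{\mathcal W}\}\in K$; finitely coherent if K1–K4 hold and K5 holds for non-empty finite $\mathcal W\subseteq K$. An SDS $K$ is finitary if every $S\in K$ has a finite subset belonging to $K$. An SDFS is any $F\subseteq\mathcal Q(\mathcal T)$; it is finitely coherent if (F1) $\emptyset\notin F$; (F2) if $A_1\in F$ and $A_1\subseteq A_2\in\mathcal Q(\mathcal T)$ then $A_2\in F$; (F3) if $A\in F$ then $A\setminus\mathcal T_-\in F$; (F4) $\{t\}\in F$ for all $t\in\mathcal T_+$; (F5) for every non-empty finite $\mathcal V\subseteq F$ and every family $(t_\sigma)_{\sigma\in\Sigma_{\mathcal V}}$ with $t_\sigma\in\mathrm{cl}(\sigma(\mathcal V))$, $\{t_\sigma:\sigma\in\Sigma_{\mathcal V}\}\in F$. *)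

(* Defs.v *)
From mathcomp Require Import all_boot.
From mathcomp Require Import boolp classical_sets functions cardinality.

Set Implicit Arguments.
Unset Strict Implicit.
Unset Printing Implicit Defensive.

Local Open Scope classical_set_scope.

Record closure_operator (T : Type) (cl : set T -> set T) : Prop := {
  cl_extensive : forall A, A `<=` cl A ;
  cl_monotone : forall A B, A `<=` B -> cl A `<=` cl B ;
  cl_idempotent : forall A, cl (cl A) = cl A }.

Definition finitary_closure (T : Type) (cl : set T -> set T) : Prop :=
  forall A, cl A = \bigcup_(G in [set G | G `<=` A /\ finite_set G]) cl G.

Definition finite_subsets (T : Type) : set (set T) := [set A | finite_set A].

(* The selections live on [W] viewed as a type, not on all of [set T]: were they
   total maps on [set T], a family indexed by the selections of a finite [W] could
   take several values on selections that agree on [W], and the sets that it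
   generates in the closure axioms below could be infinite even when all members
   of [W] are finite. *)
Definition selections (T : Type) (W : set (set T)) : set (W -> T) :=
  [set s | forall S : W, val S (s S)].

Arguments selections {T} W _.

(* [K] contains every set obtained by choosing, for each selection [s] of [W],
   one element of [cl (s(W))]. *)
Definition closed_under_selections (T : Type) (cl : set T -> set T)
    (K W : set (set T)) : Prop :=
  forall t : selections W -> T,
    (forall s : selections W, cl (range (val s)) (t s)) -> K (range t).

(* The forbidden things are [Tm]; the things that are always desirable are
   [cl set0]. *)
Record coherent_SDS (T : Type) (cl : set T -> set T) (Tm : set T)
    (K : set (set T)) : Prop := {
  coherent_set0 : ~ K set0 ;
  coherent_up : forall S1 S2, K S1 -> S1 `<=` S2 -> K S2 ;
  coherent_forbidden : forall S, K S -> K (S `\` Tm) ;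
  coherent_sing : forall t, cl set0 t -> K [set t] ;
  coherent_cl : forall W : set (set T), W !=set0 -> W `<=` K ->
    closed_under_selections cl K W }.

Record fin_coherent_SDS (T : Type) (cl : set T -> set T) (Tm : set T)
    (K : set (set T)) : Prop := {
  fin_coherent_set0 : ~ K set0 ;
  fin_coherent_up : forall S1 S2, K S1 -> S1 `<=` S2 -> K S2 ;
  fin_coherent_forbidden : forall S, K S -> K (S `\` Tm) ;
  fin_coherent_sing : forall t, cl set0 t -> K [set t] ;
  fin_coherent_cl : forall W : set (set T), W !=set0 -> finite_set W ->
    W `<=` K -> closed_under_selections cl K W }.

Definition finitary_SDS (T : Type) (K : set (set T)) : Prop :=
  forall S, K S -> exists A, [/\ A `<=` S, finite_set A & K A].

Record fin_coherent_SDFS (T : Type) (cl : set T -> set T) (Tm : set T)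
    (F : set (set T)) : Prop := {
  SDFS_finite : F `<=` @finite_subsets T ;
  SDFS_set0 : ~ F set0 ;
  SDFS_up : forall A1 A2, F A1 -> A1 `<=` A2 -> finite_subsets A2 -> F A2 ;
  SDFS_forbidden : forall A, F A -> F (A `\` Tm) ;
  SDFS_sing : forall t, cl set0 t -> F [set t] ;
  SDFS_cl : forall V : set (set T), V !=set0 -> finite_set V ->
    V `<=` F -> closed_under_selections cl F V }.

Definition up (T : Type) (F : set (set T)) : set (set T) :=
  [set S | exists2 A, F A & A `<=` S].

Definition finite_part (T : Type) (K : set (set T)) : set (set T) :=
  K `&` @finite_subsets T.

(* Main.v *)
(* For the closure axiom of [up F], choose in every S of W a member A(S) of F;
   each selection r of V = A(W) pulls back to the selection S |-> r(A(S)) of W,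
   which has the same range. So [F] contains a subset of the set to be generated.
   For the closure axiom of [finite_part K], a finite set of finite sets has only
   finitely many selections, so the generated set is finite. *)
Require Import Defs.
From mathcomp Require Import all_boot.
From mathcomp Require Import boolp classical_sets functions cardinality.

Local Open Scope classical_set_scope.

(** Every such [s] takes its values in the finite union of the [B i], so it is coded by a finite
    function between an enumeration of [I] and one of that union. *)
Lemma finite_dep_prod (I T : Type) (B : I -> set T) :
  finite_set [set: I] -> (forall i, finite_set (B i)) ->
  finite_set [set s : I -> T | forall i, B i (s i)].
Proof.
move=> finI finB.
have [sI sIE] := (finite_seqP (_ : set {classic I})).1 finI.
have [sT sTE] := (finite_seqP (_ : set {classic T})).1
  (bigcup_finite finI (fun i _ => finB i)).
have mem_sI (i : {classic I}) : i \in sI.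
  by have : [set: {classic I}] i by []; rewrite sIE.
(* [f] decodes a finite function; its image is finite and contains every admissible [s]. *)
pose f (g : {ffun seq_sub sI -> seq_sub sT}) : I -> T :=
  fun i => ssval (g (SeqSub (mem_sI i))).
apply: sub_finite_set (finite_image f (@finite_finset _ setT)) => s sB.
have mem_sT i : (s i : {classic T}) \in sT.
  suff : (\bigcup_(i in setT) B i) (s i) by rewrite sTE.
  by exists i.
exists [ffun i : seq_sub sI => SeqSub (mem_sT (ssval i))] => //.
by apply/funext => i; rewrite /f ffunE.
Qed.

Lemma finite_selections (T : Type) (V : set (set T)) :
  finite_set V -> V `<=` @finite_subsets T -> finite_set (selections V).
Proof.
move=> finV VT; apply: finite_dep_prod.
  by rewrite (eq_finite_set (card_setT V)).
by move=> S; apply: VT; exact: set_valP.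
Qed.

Lemma up_closed_under_selections (T : Type) (cl : set T -> set T)
    (F W : set (set T)) :
  (forall V, V !=set0 -> finite_set V -> V `<=` F ->
     closed_under_selections cl F V) ->
  W !=set0 -> finite_set W -> W `<=` up F ->
  closed_under_selections cl (up F) W.
Proof.
move=> Fcl [S0 WS0] finW WF t tcl.
(* [choice] asks for a value at every set; outside [W] the default is [set0]. *)
have /choice[A AP] (S : set T) : exists A, W S -> F A /\ A `<=` S.
  have [/WF[A FA AS]|nWS] := pselect (W S); first by exists A.
  by exists set0.
pose V := A @` W.
have AV (S : W) : A (val S) \in V.
  by apply/mem_set; exists (val S) => //; exact: set_valP.
pose AVS (S : W) : V := exist (fun S => S \in V) _ (AV S).
(* The pullback selects from [S] because [r] selects from [A S], a subset of [S]. *)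
have selP (r : selections V) : (fun S : W => val r (AVS S)) \in selections W.
  apply/mem_set => S; have [_] := AP _ (set_valP S); apply.
  exact: (set_valP r (AVS S)).
pose pull r : selections W := exist (fun s => s \in selections W) _ (selP r).
exists (range (t \o pull)); last by move=> _ [r _ <-]; exists (pull r).
apply: (Fcl V).
- by exists (A S0), S0.
- exact: finite_image.
- by move=> _ [S WS <-]; have [] := AP S WS.
- move=> r; suff <- : range (val (pull r)) = range (val r) by exact: tcl.
  apply/seteqP; split=> _ [S _ <-]; first by exists (AVS S).
  have [S' WS' AS'] := set_valP S.
  (* Elements of [V] with the same underlying set are equal, whichever preimage [S'] in [W] was
     picked. *)
  exists (exist (fun S => S \in W) S' (mem_set WS')) => //=; congr (val r _).
  exact/val_inj.
Qed.

Theorem theorem14 (T : Type) (T_nonempty : [set: T] !=set0)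
    (cl : set T -> set T) (cl_closure : closure_operator cl)
    (Tm : set T) (Tp_Tm : cl set0 `&` Tm = set0)
    (cl_finitary : finitary_closure cl) :
  [/\ forall F : set (set T),
        fin_coherent_SDFS cl Tm F -> fin_coherent_SDS cl Tm (up F),
      forall K : set (set T),
        coherent_SDS cl Tm K \/ fin_coherent_SDS cl Tm K ->
        fin_coherent_SDFS cl Tm (finite_part K),
      forall K : set (set T),
        finitary_SDS K -> fin_coherent_SDS cl Tm K -> up (finite_part K) = K
    & forall F : set (set T),
        fin_coherent_SDFS cl Tm F -> finite_part (up F) = F].
Proof.
split.
- move=> F [_ F0 _ FTm Fsing Fcl]; split.
  + by move=> [A FA]; rewrite subset0 => A0; apply: F0; rewrite -A0.
  + by move=> S1 S2 [A FA AS1] S12; exists A => //; exact: subset_trans S12.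
  + by move=> S [A FA AS]; exists (A `\` Tm); [exact: FTm|exact: setSD].
  + by move=> t /Fsing Ft; exists [set t].
  + by move=> W; exact: up_closed_under_selections.
- move=> K Kcoh.
  (* Coherence gives the closure axiom for all non-empty [W], in particular the finite ones, so both
     cases become one. *)
  have {Kcoh} [K0 Kup KTm Ksing Kcl] : fin_coherent_SDS cl Tm K.
    by case: Kcoh => // -[K0 Kup KTm Ksing Kcl]; split=> // W W0 _; exact: Kcl.
  split.
  + by move=> A [].
  + by case.
  + by move=> A1 A2 [KA1 _] A12 finA2; split=> //; exact: Kup A12.
  + by move=> A [KA finA]; split; [exact: KTm|exact: finite_setD].
  + by move=> t /Ksing Kt; split=> //; exact: finite_set1.
  + move=> V V0 finV VK t tcl; split.
      by apply: (Kcl V) tcl => // S /VK[].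
    (* The family [t] is indexed by the subtype of selections, which is equinumerous with the set of
       selections. *)
    apply: finite_image; rewrite (eq_finite_set (card_setT _)).
    by apply: finite_selections => // S /VK[].
(* Upward closure gives the inclusion into [K]; finitariness of [K] gives the converse. *)
- move=> K Kfin [_ Kup _ _ _]; apply/seteqP; split=> S.
    by move=> [A [KA _] AS]; exact: Kup AS.
  by move=> /Kfin[A [AS finA KA]]; exists A.
- move=> F [Ffin _ Fup _ _ _]; apply/seteqP; split=> S.
    by move=> [[A FA AS] finS]; exact: Fup AS finS.
  by move=> FS; split; [exists S|exact: Ffin].
Qed.
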